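(* The numbers $c_r$ satisfy $$c_r \le \frac{r}{2}\left(\frac{14}{15}\right)^{r/4} + o(1),$$ where the $o(1)$ term is as $r \to \infty$.
   Context: For $n \ge r \ge 1$, $K_n^{(r)}$ denotes the complete $r$-uniform hypergraph on $n$ vertices, i.e. the collection of all $r$-element subsets of an $n$-element vertex set. A complete $r$-partite $r$-graph is an $r$-uniform hypergraph whose edge set is, for some pairwise disjoint non-empty vertex sets $A_1,\dots,A_r$, the collection of all $r$-sets containing exactly one vertex from each $A_i$. $f_r(n)$ denotes the minimum number of complete $r$-partite $r$-graphs (on subsets of the vertex set) whose edge sets partition the edge set of $K_n^{(r)}$. For each fixed $r$, $c_r$ denotes the least number $c$ such that $f_r(n) \le c\,(1+o(1))\binom{n}{\lfloor r/2 \rfloor}$ as $n \to \infty$ (with $r$ fixed). *)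

(* Defs.v *)
From HB Require Import structures.
From mathcomp Require Import all_boot all_order all_algebra.
Set Implicit Arguments.
Unset Strict Implicit.
Unset Printing Implicit Defensive.
Import Order.TTheory GRing.Theory Num.Theory.

Section Hypergraphs.
Variables (V : finType) (r : nat).
Implicit Types (H : {set {set V}}) (P : {set {set {set V}}}).

Definition complete_hypergraph : {set {set V}} := [set e : {set V} | #|e| == r].

Definition is_complete_multipartite H : bool :=
  [exists A : {ffun 'I_r -> {set V}},
    [&& [forall i, A i != set0],
        [forall i, forall j, (i != j) ==> [disjoint A i & A j]]
      & H == [set e : {set V} |
                (#|e| == r) && [forall i, #|e :&: A i| == 1%N]]]].

(* Since the parts are non-empty and pairwise disjoint, hence distinct, a
   decomposition can be recorded as a set of edge sets rather than a list. *)
Definition is_decomposition P : bool :=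
  partition P complete_hypergraph &&
  [forall H in P, is_complete_multipartite H].

Lemma multipartite_set1 (e : {set V}) :
  #|e| = r -> is_complete_multipartite [set e].
Proof.
move=> er; apply/existsP.
exists [ffun i => [set enum_val (cast_ord (esym er) i)]].
apply/and3P; split.
- by apply/forallP => i; rewrite ffunE; apply/set0Pn; eexists; apply/set11.
- apply/forallP => i; apply/forallP => j; apply/implyP => ij.
  rewrite !ffunE disjoints1 inE; apply: contra ij => /eqP.
  by move=> /enum_val_inj /cast_ord_inj ->.
- apply/eqP/setP => d; rewrite !inE; apply/eqP/andP => [->|[/eqP dr /forallP dA]].
    split; first by rewrite er.
    apply/forallP => i; rewrite ffunE (setIidPr _) ?cards1 //.
    by rewrite sub1set enum_valP.
  apply/esym/eqP; rewrite eqEcard dr er leqnn andbT; apply/subsetP => x xe.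
  have := dA (cast_ord er (enum_rank_in xe x)).
  rewrite ffunE cast_ordK enum_rankK_in // => /cards1P[y xy].
  have : y \in d :&: [set x] by rewrite xy set11.
  by rewrite !inE => /andP[yd /eqP <-].
Qed.

Lemma decomposition_set1 :
  is_decomposition [set [set e] | e in complete_hypergraph].
Proof.
apply/andP; split; last first.
  apply/forall_inP => H /imsetP[e]; rewrite inE => /eqP er ->.
  exact: multipartite_set1.
apply/and3P; split.
- apply/eqP/setP => e; apply/bigcupP/idP => [[H /imsetP[d dK ->]]|eK].
    by rewrite inE => /eqP ->.
  by exists [set e]; rewrite ?set11 //; apply: imset_f.
- apply/trivIsetP => H1 H2 /imsetP[d _ ->] /imsetP[e _ ->] de.
  by rewrite disjoints1 inE; apply: contra de => /eqP ->.
- by apply/imsetP => -[e _ /setP/(_ e)]; rewrite !inE eqxx.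
Qed.

Lemma exists_decomposition :
  exists k, [exists P, is_decomposition P && (#|P| == k)].
Proof.
eexists; apply/existsP; eexists; apply/andP; split; last exact: eqxx.
exact: decomposition_set1.
Qed.

End Hypergraphs.

Definition f_ (r n : nat) : nat := ex_minn (exists_decomposition 'I_n r).

(* Loaded only here: MathComp-Analysis shadows set0, set1 and the like. *)
From mathcomp Require Import all_classical all_reals all_analysis.
Import numFieldNormedType.Exports.
Local Open Scope classical_set_scope.
Local Open Scope ring_scope.

Definition asymptotic_bound (R : realType) (r : nat) (c : R) : Prop :=
  exists o : R^nat, o @ \oo --> (0 : R) /\
    \forall n \near \oo, (f_ r n)%:R <= c * (1 + o n) * 'C(n, r./2)%:R.

(* The infimum is taken in \bar R so that, with no admissible c, it would be +oo;
   the real-valued inf would give 0. By c_least below, it equals the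
   least admissible c whenever there is one. *)
Definition c_ (R : realType) (r : nat) : \bar R :=
  ereal_inf [set c%:E | c in [set c : R | asymptotic_bound r c]].

Lemma c_least (R : realType) (r : nat) (c : R) :
  asymptotic_bound r c -> (forall d, asymptotic_bound r d -> c <= d) ->
  c_ R r = c%:E.
Proof.
move=> rc le_c; apply/eqP; rewrite eq_le; apply/andP; split.
  by apply: ereal_inf_lbound; exists c.
by apply: le_ereal_inf_tmp => _ [d rd <-]; rewrite lee_fin; exact: le_c.
Qed.

(* Main.v *)
Require Import Defs.
From HB Require Import structures.
From mathcomp Require Import all_boot all_order all_algebra zify ring.
Set Implicit Arguments.
Unset Strict Implicit.
Unset Printing Implicit Defensive.

(** Both (r/2)(14/15)^(r/4) and the error term tend to 0 and the former is
    non-negative, so the claim amounts to c_r -> 0. It is proved in the form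
    c_r <= C / (k + 1) with C an absolute constant and k = floor(r/2).

    The saving comes from dimension 4. The product E(K_4) x E(K_6) splits into
    14 products of bicliques ([K4xK6_partition]), one less than the 3 * 5
    obtained by multiplying optimal biclique partitions of K_4 and K_6. The
    edges of K_s split into about s/3 complete 4-partite graphs, and also into
    about s/5 complete 6-partite ones ([complete_multicuts]); blowing up the 14
    products shows that the 4-sets with two vertices in each of two disjoint
    s-sets cost (14/15 + o(1)) s^2 ([decomposes_pairs]), against (s - 1)^2 for
    the product construction.

    To exploit this for large r, spread the n vertices over t blocks of size
    about s = n/t and sort the r-sets by their profile, the number of vertices
    in each block. A profile p costs at most s^(sum of floor(p_i / 2)), whose
    exponent never exceeds k, and only the profiles with exponent k matter as n
    grows. If t is large compared with r, nearly all of these have k blocks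
    with two vertices each, one of which may have three. Grouping the blocks
    with two vertices into pairs gains a factor 14/15 per pair, that is
    (14/15)^floor((k-1)/2) in all ([decomposes_profile_pairs]). There are at most
    (k + 1) C(t, k) such profiles ([card_main_profiles]), and O(t^(k-1)) others
    of exponent k ([card_small_profiles]).

    For odd r there is one obstacle: a profile with k twos and a single 1 also
    has exponent k, and there are about t C(t, k) of them, which would ruin the
    estimate. But a single vertex lying anywhere in the union of all blocks not
    otherwise used is one part of a box, so these profiles are merged, at the
    price of one ([decomposes_one_single]).

    Altogether f_r(n) is at most about 2 (k + 1) (14/15)^floor((k-1)/2) n^k / k!
    plus terms made small by the choice of t, whereas C(n, k) is about n^k / k!. *)

(** * Partitions into boxes *)

Section Boxes.
Variable V : finType.
Implicit Types (e S T U W : {set V}) (A : seq {set V}) (L : seq (seq {set V})).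
Implicit Types (F : {set V} -> bool).

Definition transversal A e :=
  (e \subset \bigcup_(S <- A) S) && all (fun S => #|e :&: S| == 1) A.

Definition box U (r : nat) A :=
  [&& size A == r, all (fun S => S \subset U) A
    & pairwise (fun S T => [disjoint S & T]) A].

(** The boxes form a list and are counted with multiplicity, so that the
    partition property is a single equation and sums and products of partitions
    become sums of counts. *)
Definition decomposes U r k F := exists L,
  [/\ size L <= k, all (box U r) L & forall e, count (transversal^~ e) L = F e].

Lemma bigcup_box U r A : box U r A -> \bigcup_(S <- A) S \subset U.
Proof.
case/and3P=> _ /allP AU _; rewrite big_seq.
by apply: (big_ind (fun X : {set V} => X \subset U)) => [|S T|S /AU//];
   rewrite ?sub0set // subUset => -> ->.
Qed.

Lemma transversal_card U r A e : box U r A -> transversal A e -> #|e| = r.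
Proof.
case/and3P=> /eqP <- _; elim: A e => [|S A IH] e /=.
  by move=> _ /andP[]; rewrite big_nil subset0 => /eqP ->; rewrite cards0.
case/andP=> /allP SA /IH{}IH /andP[]; rewrite big_cons => eSA /= /andP[eS eA].
rewrite -(cardsID S) (eqP eS) add1n; congr _.+1.
apply: IH; apply/andP; split.
  by apply/subsetP=> x /setDP[/(subsetP eSA)]; rewrite inE => /orP[->|].
apply/allP=> T TA; move/allP: eA => /(_ T TA)/eqP <-; apply/eqP.
congr #|pred_of_set _|; apply/setP => x; rewrite !inE.
have := SA T TA; case: (boolP (x \in S)) => //= xS /disjointFr/(_ xS) ->.
by rewrite !andbF.
Qed.

Lemma eq_decomposes U r k F F' : F =1 F' -> decomposes U r k F -> decomposes U r k F'.
Proof. by move=> FF' [L [h1 h2 h3]]; exists L; split=> // e; rewrite h3 FF'. Qed.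

Lemma box_sub U U' r A : U \subset U' -> box U r A -> box U' r A.
Proof.
move=> UU'; rewrite /box => /and3P[-> /allP AU ->] /=; rewrite andbT.
by apply/allP=> S /AU SU; apply: subset_trans UU'.
Qed.

Lemma decomposes_le U U' r k k' F : U \subset U' -> k <= k' ->
  decomposes U r k F -> decomposes U' r k' F.
Proof.
move=> UU' kk' [L [h1 /allP h2 h3]]; exists L; split=> //; first exact: leq_trans kk'.
by apply/allP=> A /h2; apply: box_sub.
Qed.

Lemma decomposes_none U r F : (forall e, F e = false) -> decomposes U r 0 F.
Proof. by move=> F0; exists [::]; split=> // e; rewrite F0. Qed.

(** Subfamilies given as the fibers of a statistic [kappa] are disjoint by
    construction, so no separate disjointness argument arises when they are glued. *)
Lemma decomposes_fibers (I : finType) (kappa : {set V} -> I) U r (k : I -> nat) F :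
  (forall i, decomposes U r (k i) (fun e => F e && (kappa e == i))) ->
  decomposes U r (\sum_i k i) F.
Proof.
move=> H; have {H} [L HL] := fin_all_exists H.
exists (flatten [seq L i | i <- index_enum I]); split.
- rewrite size_flatten sumnE /shape -map_comp big_map.
  by apply: leq_sum => i _; case: (HL i).
- by apply/allP=> A /flattenP[_ /mapP[i _ ->]]; have [_ /allP h _] := HL i; apply: h.
move=> e; rewrite count_flatten -map_comp sumnE big_map.
rewrite (eq_bigr (fun i => F e && (kappa e == i) : nat)); last by move=> i _ /=; case: (HL i).
rewrite (bigD1 (kappa e)) //= eqxx andbT big1 ?addn0 // => i /negPf.
by rewrite eq_sym => ->; rewrite andbF.
Qed.

Lemma decomposes_split (b : {set V} -> bool) U r k1 k2 F :
  decomposes U r k1 (fun e => F e && b e) ->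
  decomposes U r k2 (fun e => F e && ~~ b e) -> decomposes U r (k1 + k2) F.
Proof.
move=> H1 H2; have -> : k1 + k2 = \sum_(i : bool) (if i then k1 else k2) by rewrite big_bool.
apply: (decomposes_fibers (kappa := b)) => -[].
  by apply: eq_decomposes H1 => e; case: (b e).
by apply: eq_decomposes H2 => e; case: (b e).
Qed.

Lemma transversal_cat U1 U2 r1 r2 A1 A2 e : [disjoint U1 & U2] ->
  box U1 r1 A1 -> box U2 r2 A2 ->
  transversal (A1 ++ A2) e =
    [&& e \subset U1 :|: U2, transversal A1 (e :&: U1) & transversal A2 (e :&: U2)].
Proof.
move=> dis b1 b2; have c1 := bigcup_box b1; have c2 := bigcup_box b2.
rewrite /transversal big_cat all_cat /=.
have E (U : {set V}) A r : box U r A ->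
    all (fun S => #|e :&: U :&: S| == 1) A = all (fun S => #|e :&: S| == 1) A.
  case/and3P=> _ /allP AU _; apply: eq_in_all => S /AU SU.
  by rewrite -setIA (setIidPr SU).
rewrite (E _ _ _ b1) (E _ _ _ b2).
case: (all _ A1); case: (all _ A2); rewrite ?(andbF, andbT) //=.
set X1 := (\bigcup_(S <- A1) S) in c1 *; set X2 := (\bigcup_(S <- A2) S) in c2 *.
apply/idP/and3P.
  move=> eX; split; first exact: subset_trans eX (setUSS c1 c2).
    apply/subsetP=> x /setIP[/(subsetP eX)]; rewrite inE => /orP[//|/(subsetP c2)].
    by move=> x2 x1; rewrite (disjointFr dis x1) in x2.
  apply/subsetP=> x /setIP[/(subsetP eX)]; rewrite inE => /orP[/(subsetP c1)|//].
  by move=> x1 x2; rewrite (disjointFr dis x1) in x2.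
case=> /subsetP eU /subsetP e1 /subsetP e2; apply/subsetP=> x xe.
rewrite inE; have := eU x xe; rewrite inE => /orP[x1|x2].
  by rewrite e1 // inE xe.
by rewrite e2 ?orbT // inE xe.
Qed.

Lemma box_cat U1 U2 r1 r2 A1 A2 : [disjoint U1 & U2] ->
  box U1 r1 A1 -> box U2 r2 A2 -> box (U1 :|: U2) (r1 + r2) (A1 ++ A2).
Proof.
rewrite /box => dis /and3P[/eqP <- s1 p1]; case/and3P=> /eqP <- s2 p2.
rewrite size_cat eqxx all_cat pairwise_cat p1 p2 !andbT /=.
move/allP: s1 => s1; move/allP: s2 => s2; rewrite -andbA; apply/and3P; split.
- by apply/allP=> S /s1 h; apply: subset_trans h (subsetUl _ _).
- by apply/allP=> S /s2 h; apply: subset_trans h (subsetUr _ _).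
by apply/allrelP=> S T /s1 SU /s2 TU; apply: disjointWl SU (disjointWr TU dis).
Qed.

(** A box inside [U1] followed by a box inside [U2] is a box, and its
    transversals are the unions of transversals of the two. *)
Lemma decomposes_prod U1 U2 r1 r2 k1 k2 F1 F2 : [disjoint U1 & U2] ->
  decomposes U1 r1 k1 F1 -> decomposes U2 r2 k2 F2 ->
  decomposes (U1 :|: U2) (r1 + r2) (k1 * k2)
    (fun e => [&& e \subset U1 :|: U2, F1 (e :&: U1) & F2 (e :&: U2)]).
Proof.
move=> dis [L1 [s1 /allP b1 h1]] [L2 [s2 /allP b2 h2]].
exists [seq A1 ++ A2 | A1 <- L1, A2 <- L2]; split.
- by rewrite size_allpairs leq_mul.
- by apply/allP=> _ /allpairsP[[A1 A2] /= [/b1 ? /b2 ? ->]]; apply: box_cat.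
move=> e; rewrite /= count_flatten -map_comp sumnE big_map.
rewrite big_seq (eq_bigr (fun A1 => (e \subset U1 :|: U2) *
    (transversal A1 (e :&: U1) * F2 (e :&: U2)))); last first.
  move=> A1 /b1 bA1 /=; rewrite count_map -h2 -!sum1_count big_mkcond !big_distrr /=.
  rewrite [LHS]big_seq [RHS]big_mkcond [RHS]big_seq; apply: eq_bigr => A2 /b2 bA2 /=.
  rewrite (transversal_cat e dis bA1 bA2).
  by case: (_ \subset _); case: transversal; case: transversal.
rewrite -big_seq -big_distrr -big_distrl /=.
have -> : \sum_(A <- L1) transversal A (e :&: U1) = F1 (e :&: U1).
  rewrite -h1 -sum1_count [RHS]big_mkcond /=; apply: eq_bigr => A _.
  by case: transversal.
by case: (_ \subset _); case: (F1 _); case: (F2 _).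
Qed.

Lemma decomposes_set0 U : decomposes U 0 1 (fun e => e == set0).
Proof.
exists [:: [::]]; split=> // e.
by rewrite /= addn0 /transversal big_nil subset0 andbT.
Qed.

Lemma decomposes_vertex U : decomposes U 1 1 (fun e => (e \subset U) && (#|e| == 1)).
Proof.
exists [:: [:: U]]; split=> //; first by rewrite /= /box /= subxx.
move=> e; rewrite /= addn0 /transversal big_seq1 /= andbT.
by case: (boolP (e \subset U)) => //= /setIidPl ->.
Qed.

End Boxes.

(** * The complete hypergraph: the bound n^floor(r/2) *)

Section Complete.
Variable V : finType.
Implicit Types (e S T U W : {set V}).

(** The classical construction: fix the second vertex [x] of the set in some
    order; the first one ranges over the set [W] of earlier vertices, which is a
    single part, and the other [r - 2] vertices range over the later ones, where
    one recurses. *)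
Lemma decomposes_complete N r U : #|U| <= N ->
  decomposes U r (N ^ r./2) (fun e => (e \subset U) && (#|e| == r)).
Proof.
have [m] := ubnP r; elim: m r U => // m IHm [|[|r]] U /=; rewrite ?ltnS => rm UN.
- apply: eq_decomposes (decomposes_set0 U) => e.
  by rewrite cards_eq0; case: eqP => [->|]; rewrite ?sub0set ?andbF.
- exact: decomposes_vertex.
(* [W] is the set of vertices already passed over. *)
have step (W : {set V}) : [disjoint W & U] -> decomposes (W :|: U) r.+2 (#|U| * N ^ r./2)
    (fun e => [&& e \subset W :|: U, #|e| == r.+2 & #|e :&: W| <= 1]).
  have [n] := ubnP #|U|; elim: n U W UN => // n IHn U W UN Un dis.
  have [->|[x xU]] := set_0Vmem U.
    rewrite cards0 mul0n setU0; apply: decomposes_none => e.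
    by case: (boolP (e \subset W)) => //= /setIidPl ->; case: eqP => // ->.
  have xW : x \notin W by rewrite (disjointFl dis).
  have dxU := cardsD1 x U; rewrite xU add1n in dxU.
  have EU : W :|: U = (x |: W) :|: (U :\ x).
    by rewrite (setUC [set x]) -setUA setD1K.
  rewrite dxU mulSn addnC.
  apply: (decomposes_split (b := fun e => #|e :&: (x |: W)| <= 1)).
    have : decomposes (x |: W :|: U :\ x) r.+2 (#|U :\ x| * N ^ r./2)
        (fun e => [&& e \subset x |: W :|: U :\ x, #|e| == r.+2 & #|e :&: (x |: W)| <= 1]).
      apply: IHn; [lia|lia|].
      rewrite -setI_eq0; apply/eqP/setP=> y; rewrite !inE.
      by case: eqP => //= _; apply/andP => -[/(disjointFr dis)->].
    rewrite -EU; apply: eq_decomposes => e; rewrite -!andbA; do 2 congr (_ && _).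
    apply/idP/andP => [h|[]//]; split=> //; apply: leq_trans h.
    by apply/subset_leq_card/setIS/subsetUr.
  have d1 : [disjoint W & [set x]] by rewrite disjoint_sym disjoints1.
  have d2 : [disjoint W :|: [set x] & U :\ x].
    rewrite -setI_eq0; apply/eqP/setP=> y; rewrite !inE.
    by case: eqP => //= _; rewrite ?andbF ?orbF //; apply/andP => -[/(disjointFr dis)->].
  have := decomposes_prod d2 (decomposes_prod d1 (decomposes_vertex W) (decomposes_vertex [set x])) 
     (IHm r (U :\ x) _ _).
  rewrite !mul1n (setUC W) -EU !add1n => H; apply: eq_decomposes (H _ _); [|lia|lia].
  move=> e; rewrite -!andbA; case: (boolP (e \subset _)) => //= eU.
  have cW : #|e :&: (x |: W)| = #|e :&: W| + #|e :&: [set x]|.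
    rewrite setUC setIUr -cardsUI -setIIr (disjoint_setI0 d1) setI0 cards0.
    by rewrite addn0.
  have ce : #|e| = #|e :&: (x |: W)| + #|e :&: (U :\ x)|.
    rewrite -cardsUI -setIUr -EU (setIidPl eU) -setIIr setUC.
    by rewrite (disjoint_setI0 d2) setI0 cards0 addn0.
  have c1 : #|e :&: [set x]| <= 1 by rewrite -(cards1 x) subset_leq_card ?subsetIr.
  rewrite !subsetIr (setUC [set x] W) -!setIA (setIidPr (subsetUl _ _)).
  rewrite (setIidPr (subsetUr _ _)) /= in cW ce *.
  rewrite setUC ce cW; lia.
have /= H := step set0; rewrite expnS; rewrite set0U in H.
apply: decomposes_le (leq_mul UN (leqnn _)) _ => //.
apply: eq_decomposes (H _) => [e|]; last by rewrite -setI_eq0 set0I.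
by rewrite setI0 cards0 andbT.
Qed.
End Complete.

(** * Fourteen products of bicliques *)

(** The idea behind the list: attach to each perfect matching of K_4 a biclique
    partition of K_6. The union of two perfect matchings is a 4-cycle, which is
    a biclique, so a biclique of K_6 used by exactly two of the matchings costs
    one product, and one used by a single matching costs two, one for each edge
    of the matching. The matchings 01|23, 02|13, 03|12 receive here partitions
    into 5, 6 and 5 bicliques, of which 6 are shared by two matchings and 4 are
    used once: 6 + 2 * 4 = 14. Using one partition into 5 bicliques for all the
    matchings would cost 3 * 5. *)
Definition K4xK6 : seq ((seq nat * seq nat) * (seq nat * seq nat)) := [::
  (([:: 0], [:: 1]), ([:: 0; 2; 5], [:: 1; 4]));
  (([:: 2], [:: 3]), ([:: 0; 2; 5], [:: 1; 4]));
  (([:: 0], [:: 2]), ([:: 0; 3], [:: 1; 2]));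
  (([:: 1], [:: 3]), ([:: 0; 3], [:: 1; 2]));
  (([:: 0], [:: 3]), ([:: 0; 4], [:: 1; 3; 5]));
  (([:: 1], [:: 2]), ([:: 0; 4], [:: 1; 3; 5]));
  (([:: 0; 1], [:: 2; 3]), ([:: 0; 2], [:: 4]));
  (([:: 0; 1], [:: 2; 3]), ([:: 2; 5], [:: 1]));
  (([:: 0; 2], [:: 1; 3]), ([:: 0; 3; 5], [:: 2]));
  (([:: 0; 2], [:: 1; 3]), ([:: 3], [:: 1; 5]));
  (([:: 0; 3], [:: 1; 2]), ([:: 0], [:: 3; 5]));
  (([:: 0; 3], [:: 1; 2]), ([:: 4], [:: 1; 3]));
  (([:: 0], [:: 2]), ([:: 2; 3; 4], [:: 5]));
  (([:: 1], [:: 3]), ([:: 2; 3; 4], [:: 5]))].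

Definition joins (B : seq nat * seq nat) i j :=
  (i \in B.1) && (j \in B.2) || (j \in B.1) && (i \in B.2).

Definition distinct_colors q i j := [&& i != j, i < q & j < q].

Definition biclique q (B : seq nat * seq nat) :=
  all (ltn^~ q) (B.1 ++ B.2) && ~~ has [in B.1] B.2.

Lemma joins_distinct q B i j : biclique q B -> joins B i j -> distinct_colors q i j.
Proof.
case/andP; rewrite all_cat => /andP[/allP s1 /allP s2] /hasPn dis.
by case/orP=> /andP[x1 x2]; move: (s1 _ x1) (s2 _ x2) (dis _ x2);
  rewrite /distinct_colors /= => -> ->; rewrite ?andbT;
  apply: contraNneq => E; move: x1; rewrite E.
Qed.

Lemma K4xK6_bicliques : all (fun B => biclique 4 B.1 && biclique 6 B.2) K4xK6.
Proof. by []. Qed.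

(** Stated for arbitrary colours, so that it applies directly to pairs of
    vertices that a cut does not separate: these contribute 0. *)
Lemma K4xK6_partition i j i' j' :
  \sum_(B <- K4xK6) joins B.1 i j * joins B.2 i' j' =
  distinct_colors 4 i j * distinct_colors 6 i' j'.
Proof.
have [/andP[]|] := boolP (distinct_colors 4 i j && distinct_colors 6 i' j').
  have check : all (fun i => all (fun j => all (fun i' => all (fun j' =>
      distinct_colors 4 i j && distinct_colors 6 i' j' ==>
      (\sum_(B <- K4xK6) joins B.1 i j * joins B.2 i' j' == 1))
    (iota 0 6)) (iota 0 6)) (iota 0 4)) (iota 0 4).
    by rewrite unlock; vm_compute.
  move=> d d'; rewrite d d'; case/and3P: (d) => _ i4 j4; case/and3P: (d') => _ i6 j6.
  have mem q x : x < q -> x \in iota 0 q by rewrite mem_iota.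
  move/allP/(_ i (mem 4 _ i4))/allP/(_ j (mem 4 _ j4)): check.
  by move/allP/(_ i' (mem 6 _ i6))/allP/(_ j' (mem 6 _ j6)); rewrite d d' => /eqP.
move=> nd; rewrite mulnb (negPf nd) big_seq big1 // => B /(allP K4xK6_bicliques)/andP[b4 b6].
rewrite mulnb; apply/eqP; rewrite eqb0; apply: contra nd => /andP[h h'].
by rewrite (joins_distinct b4 h) (joins_distinct b6 h').
Qed.

(** * Pairs in two disjoint sets *)

Section Pairs.
Variable V : finType.
Implicit Types (e S T U W : {set V}) (c d : {ffun V -> nat}).

(** Peel off [q - 1] vertices as singleton classes, with all the remaining ones
    as the last class, then continue with the remaining ones. The colour [q]
    marks vertices outside the cut. *)
Lemma complete_multicuts q U : 1 < q -> exists P : seq {ffun V -> nat},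
  [/\ size P <= #|U| %/ q.-1 + 1,
      forall c x, c \in P -> x \notin U -> c x = q
    & forall x y, x \in U -> y \in U -> x != y ->
        \sum_(c <- P) distinct_colors q (c x) (c y) = 1].
Proof.
move=> q1; have [n] := ubnP #|U|; elim: n U => // n IH U Un.
pose T := take q.-1 (enum U).
have TU x : x \in T -> x \in U by move/mem_take; rewrite mem_enum.
have sT : size T <= q.-1 by rewrite size_take; case: ltnP.
pose c := [ffun x => if x \in T then index x T else if x \in U then q.-1 else q].
have cU x : x \notin U -> c x = q.
  by move=> xU; rewrite ffunE (negPf xU); case: ifP => // /TU; rewrite (negPf xU).
have cq x : x \in U -> c x < q.
  move=> xU; rewrite ffunE xU; case: ifP => [xT|_]; last by lia.
  by apply: leq_trans (leq_pred q); apply: leq_trans sT; rewrite index_mem.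
have cT x y : x \in U -> y \in U -> x != y ->
    distinct_colors q (c x) (c y) = (x \in T) || (y \in T).
  move=> xU yU xy; rewrite /distinct_colors !cq // !andbT !ffunE xU yU.
  case: ifP => xT; case: ifP => yT /=; rewrite ?eqxx //.
  - by apply: contra xy => /eqP h; rewrite -(nth_index x xT) h nth_index.
  - by rewrite neq_ltn (leq_trans _ sT) // index_mem.
  - by rewrite neq_ltn orbC (leq_trans _ sT) // index_mem.
have [Uq|Uq] := ltnP #|U| q.-1.
  exists [:: c]; split=> [|d x|x y xU yU xy]; first by rewrite addn1.
    by rewrite inE => /eqP ->; apply: cU.
  by rewrite big_seq1 cT // /T take_oversize ?mem_enum ?xU // -cardE ltnW.
have cardT : #|U :\: [set x in T]| = #|U| - q.-1.
  rewrite cardsD (setIidPr _); last by apply/subsetP=> x; rewrite inE => /TU.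
  by rewrite cardsE (card_uniqP _) ?take_uniq ?enum_uniq // size_takel // -cardE.
have [|P [sP P0 P1]] := IH (U :\: [set x in T]); first by rewrite cardT; lia.
exists (c :: P); split=> [|d x|x y xU yU xy].
- rewrite /= addn1 ltnS; apply: leq_trans sP _; rewrite cardT.
  by rewrite -{2}(subnK Uq) divnDr // divnn; lia.
- rewrite inE => /orP[/eqP -> /cU //|dP xU].
  by apply: P0 => //; rewrite inE (negPf xU) andbF.
rewrite big_cons cT //; case: (boolP (_ || _)) => [xyT|/norP[xT yT]]; last first.
  by rewrite P1 ?inE ?xT ?yT.
rewrite big_seq big1 // => d dP; apply/eqP; rewrite eqb0.
rewrite /distinct_colors; case/orP: xyT => zT.
  by rewrite (P0 d x) ?ltnn ?andbF // !inE zT.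
by rewrite (P0 d y) ?ltnn ?andbF // !inE zT.
Qed.

Definition color_class c (s : seq nat) := [set x | c x \in s].

Definition cut_box c (B : seq nat * seq nat) := [:: color_class c B.1; color_class c B.2].

Lemma box_cut q U c B : (forall x, x \notin U -> c x = q) -> biclique q B ->
  box U 2 (cut_box c B).
Proof.
move=> cU /andP[]; rewrite all_cat => /andP[/allP s1 /allP s2] /hasPn dis.
rewrite /box /= !andbT; rewrite -andbA; apply/and3P; split.
- by apply/subsetP=> x; rewrite inE => /s1; apply: contraTT => /cU ->; rewrite /= ltnn.
- by apply/subsetP=> x; rewrite inE => /s2; apply: contraTT => /cU ->; rewrite /= ltnn.
rewrite -setI_eq0; apply/eqP/setP=> x; rewrite !inE; apply/andP=> -[x1 /dis].
by rewrite /= x1.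
Qed.

Lemma transversal_cut q c B x y : x != y -> biclique q B ->
  transversal (cut_box c B) [set x; y] = joins B (c x) (c y).
Proof.
move=> xy /andP[_ /hasPn dis].
have card1 S : #|[set x; y] :&: S| = (x \in S) + (y \in S).
  have card_set1I z : #|[set z] :&: S| = (z \in S).
    by rewrite (cardsD1 z) !inE eqxx /= (_ : _ :\ z = set0) ?cards0 ?addn0 //;
       apply/setP=> w; rewrite !inE; case: eqP.
  rewrite setIUl cardsU -setIIl (_ : [set x] :&: [set y] = set0) ?set0I ?cards0 ?subn0.
    by rewrite !card_set1I.
  by apply/setP=> w; rewrite !inE; apply/andP=> -[/eqP->]; apply/negP.
rewrite /transversal /= !big_cons big_nil setU0 !card1 subUset !sub1set !inE /joins !andbT.
have dB z : ~~ ((c z \in B.1) && (c z \in B.2)).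
  by apply/negP=> /andP[h1 /dis]; rewrite /= h1.
by move: (dB x) (dB y); do 4 case: (_ \in _).
Qed.

(** Each pair inside [U1] is separated by exactly one 4-partite cut and each
    pair inside [U2] by exactly one 6-partite cut; the 14 products, blown up
    along that pair of cuts, contain the 4-set exactly once. *)
Lemma decomposes_pairs U1 U2 : [disjoint U1 & U2] ->
  decomposes (U1 :|: U2) 4 ((#|U1| %/ 3 + 1) * (#|U2| %/ 5 + 1) * 14)
    (fun e => [&& e \subset U1 :|: U2, #|e :&: U1| == 2 & #|e :&: U2| == 2]).
Proof.
move=> dis.
have [P [sP P0 P1]] := complete_multicuts U1 (isT : 1 < 4).
have [Q [sQ Q0 Q1]] := complete_multicuts U2 (isT : 1 < 6).
have b4 c B : c \in P -> B \in K4xK6 -> box U1 2 (cut_box c B.1).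
  by move=> cP /(allP K4xK6_bicliques)/andP[h _]; apply: box_cut h => x; apply: P0.
have b6 d B : d \in Q -> B \in K4xK6 -> box U2 2 (cut_box d B.2).
  by move=> dQ /(allP K4xK6_bicliques)/andP[_ h]; apply: box_cut h => x; apply: Q0.
exists [seq cut_box cd.1 B.1 ++ cut_box cd.2 B.2 |
  cd <- [seq (c, d) | c <- P, d <- Q], B <- K4xK6]; split.
- by rewrite !size_allpairs leq_mul // leq_mul.
- apply/allP=> _ /allpairsP[[_ B] /= [/allpairsP[[c d] /= [cP dQ ->]] BK ->]].
  exact: box_cat (b4 _ _ cP BK) (b6 _ _ dQ BK).
move=> e; rewrite -sum1_count big_mkcond big_allpairs_dep big_allpairs.
have trE c d B : c \in P -> d \in Q -> B \in K4xK6 ->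
    transversal (cut_box c B.1 ++ cut_box d B.2) e =
    [&& e \subset U1 :|: U2, transversal (cut_box c B.1) (e :&: U1)
      & transversal (cut_box d B.2) (e :&: U2)].
  by move=> cP dQ BK; apply: transversal_cat dis (b4 _ _ cP BK) (b6 _ _ dQ BK).
case: (boolP [&& e \subset _, _ & _]) => [/and3P[eU /cards2P[x [y [xy e1]]] /cards2P[z [w [zw e2]]]]|nF].
  have [xU yU] : x \in U1 /\ y \in U1.
    by split; apply: (subsetP (subsetIr e U1)); rewrite e1 !inE eqxx ?orbT.
  have [zU wU] : z \in U2 /\ w \in U2.
    by split; apply: (subsetP (subsetIr e U2)); rewrite e2 !inE eqxx ?orbT.
  rewrite -[RHS](P1 x y xU yU xy) [LHS]big_seq [RHS]big_seq; apply: eq_bigr => c cP.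
  rewrite -[RHS]muln1 -[X in _ = _ * X](Q1 z w zU wU zw) big_distrr [LHS]big_seq [RHS]big_seq.
  apply: eq_bigr => d dQ.
  rewrite -[RHS]/(distinct_colors 4 (c x) (c y) * distinct_colors 6 (d z) (d w))%N -K4xK6_partition [LHS]big_seq [RHS]big_seq.
  apply: eq_bigr => B BK.
  rewrite -[transversal _ _]/(transversal (cut_box c B.1 ++ cut_box d B.2) e) trE // eU e1 e2.
  have /andP[B4 B6] := allP K4xK6_bicliques B BK.
  by rewrite (transversal_cut _ xy B4) (transversal_cut _ zw B6) /=; do 2 case: joins.
rewrite big_seq big1 // => c cP; rewrite big_seq big1 // => d dQ.
rewrite big_seq big1 // => B BK.
rewrite -[transversal _ _]/(transversal (cut_box c B.1 ++ cut_box d B.2) e).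
case: ifP => //; rewrite trE // => /and3P[eU t1 t2].
case/negP: nF; rewrite eU (transversal_card (b4 _ _ cP BK) t1).
by rewrite (transversal_card (b6 _ _ dQ BK) t2).
Qed.
End Pairs.

(** * Sets with a prescribed profile *)

Definition pair_cost s := (s %/ 3 + 1) * (s %/ 5 + 1) * 14.

Section Profiles.
Variables (V I : finType) (f : V -> I) (s : nat).
Implicit Types (e S T U W : {set V}) (J : {set I}) (p : I -> nat) (i j : I).

Definition block i := [set x | f x == i].

Definition region J := [set x | f x \in J].

Definition has_profile J p e :=
  (e \subset region J) && [forall i in J, #|e :&: block i| == p i].

Hypothesis block_le : forall i, #|block i| <= s.

Lemma region1 i : region [set i] = block i.
Proof. by apply/setP=> x; rewrite !inE. Qed.

Lemma regionU J1 J2 : region (J1 :|: J2) = region J1 :|: region J2.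
Proof. by apply/setP=> x; rewrite !inE. Qed.

Lemma disjoint_region J1 J2 : [disjoint J1 & J2] -> [disjoint region J1 & region J2].
Proof.
move=> dis; rewrite -setI_eq0; apply/eqP/setP=> x; rewrite !inE.
by apply/andP=> -[/(disjointFr dis) ->].
Qed.

Lemma block_sub_region i J : i \in J -> block i \subset region J.
Proof. by move=> iJ; apply/subsetP=> x; rewrite !inE => /eqP ->. Qed.

Lemma card_region e J : #|e :&: region J| = \sum_(i in J) #|e :&: block i|.
Proof.
rewrite -sum1_card (partition_big f (mem J)) /=; last first.
  by move=> x; rewrite !inE => /andP[].
apply: eq_bigr => i iJ; rewrite -sum1_card; apply: eq_bigl => x.
by rewrite !inE; case: eqP => [->|]; rewrite ?andbF ?iJ ?andbT.
Qed.

Lemma has_profileU J1 J2 p e : [disjoint J1 & J2] ->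
  [&& e \subset region J1 :|: region J2, has_profile J1 p (e :&: region J1)
    & has_profile J2 p (e :&: region J2)] = has_profile (J1 :|: J2) p e.
Proof.
move=> dis; rewrite /has_profile regionU !subsetIr /=; congr (_ && _).
have E J : [forall i in J, #|e :&: region J :&: block i| == p i] =
           [forall i in J, #|e :&: block i| == p i].
  apply: eq_forallb_in => i iJ.
  by rewrite -setIA (setIidPr (block_sub_region iJ)).
rewrite !E; apply/andP/forall_inP => [[/forall_inP h1 /forall_inP h2] i|h].
  by rewrite inE => /orP[/h1|/h2].
by split; apply/forall_inP=> i iJ; apply: h; rewrite inE iJ ?orbT.
Qed.

Lemma decomposes_profileU J1 J2 p r1 r2 k1 k2 : [disjoint J1 & J2] ->
  decomposes (region J1) r1 k1 (has_profile J1 p) ->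
  decomposes (region J2) r2 k2 (has_profile J2 p) ->
  decomposes (region (J1 :|: J2)) (r1 + r2) (k1 * k2) (has_profile (J1 :|: J2) p).
Proof.
move=> dis H1 H2; rewrite regionU.
apply: eq_decomposes (decomposes_prod (disjoint_region dis) H1 H2) => e.
exact: has_profileU.
Qed.

Lemma has_profile1 i p e :
  has_profile [set i] p e = (e \subset block i) && (#|e| == p i).
Proof.
rewrite /has_profile region1; case: (boolP (e \subset _)) => //= /setIidPl eB.
apply/forall_inP/idP => [/(_ i (set11 _))|H j]; first by rewrite eB.
by rewrite inE => /eqP ->; rewrite eB.
Qed.

Lemma decomposes_profile J p :
  decomposes (region J) (\sum_(i in J) p i) (s ^ \sum_(i in J) (p i)./2)
    (has_profile J p).
Proof.
have [n] := ubnP #|J|; elim: n J => // n IH J Jn.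
have [->|[i iJ]] := set_0Vmem J.
  rewrite !big_set0; apply: eq_decomposes (decomposes_set0 _) => e.
  rewrite /has_profile (_ : region set0 = set0); last by apply/setP=> x; rewrite !inE.
  rewrite subset0; case: eqP => //= _; apply/esym/forall_inP=> j.
  by rewrite inE.
rewrite !(big_setD1 i iJ) /= expnD -{1 4}(setD1K iJ).
apply: decomposes_profileU; first by rewrite disjoints1 setD11.
  rewrite region1; apply: eq_decomposes (decomposes_complete _ (block_le i)) => e.
  by rewrite has_profile1.
by apply: IH; rewrite (cardsD1 i) iJ in Jn.
Qed.

(** Two blocks that each receive two vertices are treated together at cost
    [pair_cost s] instead of [s ^ 2]; this is done [h] times. *)
Lemma decomposes_profile_pairs h J p : h.*2 <= #|[set i in J | p i == 2]| ->
  decomposes (region J) (\sum_(i in J) p i)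
    (pair_cost s ^ h * s ^ (\sum_(i in J) (p i)./2 - h.*2)) (has_profile J p).
Proof.
elim: h J => [|h IH] J hJ; first by rewrite mul1n subn0; apply: decomposes_profile.
have [i iT] : exists i, i \in [set i in J | p i == 2].
  by apply/set0Pn; rewrite -card_gt0; lia.
move: hJ; rewrite (cardsD1 i) iT => hJ.
have [j jT] : exists j, j \in [set i in J | p i == 2] :\ i.
  by apply/set0Pn; rewrite -card_gt0; lia.
move: hJ; rewrite (cardsD1 j) jT => hJ.
move: iT jT; rewrite !inE => /andP[iJ /eqP pi] /and3P[ji jJ /eqP pj].
have jJ' : j \in J :\ i by rewrite !inE ji.
have EJ : J = [set i; j] :|: (J :\ i :\ j) by rewrite -setUA !setD1K.
rewrite !(big_setD1 i iJ) !(big_setD1 j jJ') /= pi pj !addnA.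
rewrite (_ : 2 + 2 = 4) // (_ : 2./2 + 2./2 = 2) //.
have subn2 X : 2 + X - h.+1.*2 = X - h.*2 by lia.
rewrite expnS -mulnA subn2 {1 4}EJ.
apply: decomposes_profileU.
- rewrite -setI_eq0; apply/eqP/setP=> l; rewrite !inE.
  by case: eqP; case: eqP; rewrite ?andbF.
- have dij : [disjoint [set i] & [set j]] by rewrite disjoints1 inE eq_sym.
  have := decomposes_pairs (disjoint_region dij).
  rewrite -regionU => H; apply: eq_decomposes (decomposes_le (subxx _) _ H) => [e|].
    rewrite -has_profileU // !has_profile1 !region1 pi pj !subsetIr regionU !region1.
    by [].
  by rewrite !region1 /pair_cost leq_mul // leq_mul // leq_add2r leq_div2r.
apply: IH; have -> : [set l in J :\ i :\ j | p l == 2] = [set l in J | p l == 2] :\ i :\ j.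
  by apply/setP=> l; rewrite !inE -!andbA.
by move: hJ; lia.
Qed.

End Profiles.

(** * Counting the profiles of maximal exponent *)

Section Counting.
Variables (I : finType) (r k : nat).
Implicit Types (a : {ffun I -> 'I_r.+1}) (i j : I).

Definition support a := [set i | a i != 0 :> nat].

Definition weight a := \sum_i (a i)./2.

(** The profiles whose number exceeds the order of t^(k-1): those of maximal
    exponent spread over as many blocks as possible. *)
Definition main_profiles := [set a | [&& weight a == k, [forall i, a i != 1 :> nat],
  \sum_i a i <= k.*2.+1 & k <= #|support a|]].

Definition small_profiles := [set a | #|support a| < k].

(** Every block of the support contributes at least 1 to the weight, hence
    exactly 1 when the support has [k] elements; the values are then 2 or 3, and
    each 3 adds 1 to the sum beyond [2 k]. *)
Lemma main_profilesP a : a \in main_profiles ->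
  [/\ #|support a| = k, forall i, [|| a i == 0 :> nat, a i == 2 :> nat | a i == 3 :> nat]
    & #|[set i | a i == 3 :> nat]| <= 1].
Proof.
rewrite inE => /and4P[/eqP wa /forallP a1 sa ka].
have cs : #|support a| = \sum_i (i \in support a).
  by rewrite -sum1_card big_mkcond; apply: eq_bigr => i _; case: ifP.
have pt i : (i \in support a) <= (a i)./2 ?= iff ((i \in support a : nat) == (a i)./2).
  by split=> //; rewrite inE; move: (a1 i); case: (nat_of_ord (a i)) => [|[|m]].
have [le_sum eq_sum] := leqif_sum (fun i (_ : true) => pt i).
have kE : #|support a| = k by apply/eqP; rewrite eqn_leq ka andbT cs -wa.
have /forallP /= eqs : [forall i, (i \in support a : nat) == (a i)./2].
  by rewrite -eq_sum -cs kE -wa.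
have vals i : [|| a i == 0 :> nat, a i == 2 :> nat | a i == 3 :> nat].
  by move: (eqs i) (a1 i); rewrite inE; case: (nat_of_ord (a i)) => [|[|[|[|m]]]] //= /eqP.
split=> //; have -> : #|[set i | a i == 3 :> nat]| = \sum_i odd (a i).
  rewrite -sum1_card big_mkcond; apply: eq_bigr => i _; rewrite inE.
  by case/or3P: (vals i) => /eqP ->.
rewrite -(leq_add2r k.*2) add1n; apply: leq_trans sa.
rewrite -wa /weight -muln2 big_distrl -big_split /=; apply: leq_sum => i _.
by rewrite muln2 odd_double_half.
Qed.

(** A main profile is determined by its support and the rank in it of the block
    with value 3; the extra rank [k] stands for no such block. *)
Lemma card_main_profiles : #|main_profiles| <= 'C(#|I|, k) * k.+1.
Proof.
pose g (Dj : {set I} * 'I_k.+1) : {ffun I -> 'I_r.+1} := [ffun i =>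
  inord (if i \in Dj.1 then 2 + (index i (enum Dj.1) == Dj.2) else 0)].
have <- : #|setX [set D : {set I} | #|D| == k] [set: 'I_k.+1]| = 'C(#|I|, k) * k.+1.
  by rewrite cardsX cardsT card_ord -card_draws.
apply: leq_trans (leq_imset_card g _); apply/subset_leq_card/subsetP=> a /main_profilesP.
case=> ka vals three; pose is3 i := a i == 3 :> nat; pose D := support a.
have jk : find is3 (enum D) < k.+1 by rewrite ltnS -ka cardE find_size.
apply/imsetP; exists (D, Ordinal jk); first by rewrite !inE ka eqxx.
apply/ffunP=> i; rewrite ffunE /= -[LHS]inord_val; congr inord.
case: ifPn => iD; last by apply/eqP; move: iD; rewrite inE negbK.
have iE : i \in enum D by rewrite mem_enum.
have idx : (index i (enum D) == find is3 (enum D)) = is3 i.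
  apply/eqP/idP => [E|i3].
    have h3 : has is3 (enum D) by rewrite has_find -E index_mem.
    by have := nth_find i h3; rewrite -E nth_index.
  have h3 : has is3 (enum D) by apply/hasP; exists i.
  have n3 := nth_find i h3; rewrite /is3 in i3 n3.
  set i0 := nth i _ _ in n3; have <- : i0 = i.
    by apply: (card_le1_eqP three); rewrite inE.
  by rewrite index_uniq ?enum_uniq // -has_find.
rewrite idx /is3; move: iD (vals i); rewrite inE => /negPf -> /=.
by case/orP=> /eqP ->.
Qed.

(** A profile supported on fewer than [k] blocks is given by a list of [k - 1]
    blocks covering the support and the list of values there. *)
Lemma card_small_profiles : 0 < #|I| -> #|small_profiles| <= (#|I| * r.+1) ^ k.-1.
Proof.
case/card_gt0P=> i0 _.
pose g (wv : k.-1.-tuple I * k.-1.-tuple 'I_r.+1) : {ffun I -> 'I_r.+1} :=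
  [ffun i => if i \in wv.1 then nth ord0 wv.2 (index i wv.1) else ord0].
have <- : #|[set: k.-1.-tuple I * k.-1.-tuple 'I_r.+1]| = (#|I| * r.+1) ^ k.-1.
  by rewrite cardsT card_prod !card_tuple card_ord expnMn.
apply: leq_trans (leq_imset_card g _); apply/subset_leq_card/subsetP=> a.
rewrite inE => ka; pose w := mktuple (fun j : 'I_k.-1 => nth i0 (enum (support a)) j).
apply/imsetP; exists (w, map_tuple a w); first by rewrite inE.
apply/ffunP=> i; rewrite ffunE /=; case: ifPn => iw.
  by rewrite (nth_map i0) ?index_mem ?nth_index.
apply/val_inj/eqP; apply: contraR iw => ai.
have iE : i \in enum (support a) by rewrite mem_enum inE.
have ik : index i (enum (support a)) < k.-1.
  by apply: leq_trans (_ : _ <= #|support a|) _; [rewrite cardE index_mem | lia].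
by apply/mapP; exists (Ordinal ik); rewrite ?mem_enum //= nth_index.
Qed.
End Counting.

(** * Summing over all profiles *)

Section Assembly.
Variables (V I : finType) (f : V -> I) (s r : nat).
Implicit Types (e S T U W : {set V}) (J : {set I}) (i j : I).
Implicit Types a : {ffun I -> 'I_r.+1}.

Hypothesis block_le : forall i, #|block f i| <= s.
Hypothesis s_gt0 : 0 < s.

Local Notation k := r./2.
Let h := k.-1./2.

(** The value [s ^ k.-1] is meant for profiles of weight below [k]; it also covers
    the functions that are not the profile of any set. *)
Definition profile_cost a :=
  if a \in main_profiles I r k then pair_cost s ^ h * s ^ (k - h.*2)
  else if a \in small_profiles I r k then s ^ k else s ^ k.-1.

Lemma sum_support (F : nat -> nat) a J : F 0 = 0 -> support a \subset J ->
  \sum_(i in J) F (a i) = \sum_i F (a i).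
Proof.
move=> F0 /subsetP aJ; rewrite [RHS](bigID (mem J)) /= [X in _ + X]big1 ?addn0 // => i.
by apply: contraNeq => Fi; apply: aJ; rewrite inE; apply: contraNneq Fi => ->; rewrite F0.
Qed.

(** The hypothesis on [a] of weight [k] is what makes a profile of maximal exponent
    either main or small. *)
Lemma decomposes_profile_cost a J : weight a <= k ->
  (weight a = k -> [forall i, a i != 1 :> nat] /\ \sum_i a i <= k.*2.+1) ->
  support a \subset J ->
  decomposes (region f J) (\sum_i a i) (profile_cost a) (has_profile f J (fun i => a i)).
Proof.
move=> wk wa aJ.
have wE : \sum_(i in J) (a i)./2 = weight a by apply: (sum_support (F := half)).
have <- : \sum_(i in J) a i = \sum_i a i by apply: (sum_support (F := id)).
have plain : decomposes (region f J) (\sum_(i in J) a i) (s ^ weight a)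
    (has_profile f J (fun i => a i)).
  by rewrite -wE; apply: decomposes_profile.
have pow n : weight a <= n -> decomposes (region f J) (\sum_(i in J) a i) (s ^ n)
    (has_profile f J (fun i => a i)).
  by move=> wn; apply: decomposes_le plain => //; apply: leq_pexp2l.
rewrite /profile_cost; case: ifP => [am|nm].
  have [ka vals three] := main_profilesP am.
  have -> : k = \sum_(i in J) (a i)./2.
    by rewrite wE; move: am; rewrite inE => /andP[/eqP].
  apply: decomposes_profile_pairs => //.
  apply: (@leq_trans (#|support a :\: [set i | a i == 3 :> nat]|)).
    rewrite cardsD ka; have := subset_leq_card (subsetIr (support a) [set i | a i == 3 :> nat]).
    by rewrite /h; lia.
  apply/subset_leq_card/subsetP=> i; rewrite !inE => /andP[i3 i0].
  by move: (vals i); rewrite (negPf i0) (negPf i3) orbF /= => ->; rewrite (subsetP aJ) ?inE.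
case: ifP => [_|ns]; first exact: pow.
apply: pow; move: wk nm ns; rewrite leq_eqVlt => /orP[/eqP wk|]; last by lia.
have [a1 sa] := wa wk.
by rewrite !inE wk eqxx a1 sa /= leqNgt => /negbFE ->.
Qed.

Definition ones (p : I -> nat) := #|[set i | p i == 1]|.

Lemma ones_weight a : ones (fun i => a i) + (weight a).*2 <= \sum_i a i.
Proof.
rewrite /ones -sum1_card big_mkcond /weight -muln2 big_distrl -big_split /=.
apply: leq_sum => i _; rewrite inE.
by case: (nat_of_ord (a i)) => [|[|m]] //=; lia.
Qed.

Lemma card_profile e : #|e| = \sum_i #|e :&: block f i|.
Proof.
have := card_region f e setT; rewrite (_ : region f setT = setT) ?setIT.
  by move=> ->; apply: eq_bigl => i; rewrite inE.
by apply/setP=> x; rewrite !inE.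
Qed.

(** For a realized profile of weight [k] the sum [r] is at most [2 k + 1], so at
    most one value is odd; since the number of ones is not 1, it is 0. *)
Lemma decomposes_exact a :
  decomposes setT r (profile_cost a) (fun e =>
    [&& #|e| == r, ones (fun i => #|e :&: block f i|) != 1
      & [ffun i => inord #|e :&: block f i|] == a]).
Proof.
have [/andP[/eqP sa a1]|bad] :=
    boolP ((\sum_i a i == r) && (ones (fun i => a i) != 1)).
  have oa := ones_weight a; rewrite sa in oa.
  have H : decomposes setT (\sum_i a i) (profile_cost a) (has_profile f setT (fun i => a i)).
    apply: decomposes_le (subsetT _) (leqnn _) _; apply: decomposes_profile_cost => //.
      lia.
    move=> wk; rewrite sa; split; last by lia.
    apply/forallP=> i; apply/negP => ai.
    have : 0 < ones (fun i => a i) by apply/card_gt0P; exists i; rewrite inE.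
    by move: a1; lia.
  rewrite -{1}sa; apply: eq_decomposes H => e.
  have -> : has_profile f setT (fun i => a i) e = [forall i, #|e :&: block f i| == a i].
    rewrite /has_profile (_ : e \subset _); last by apply/subsetP=> x; rewrite !inE.
    by apply: eq_forallb => i; rewrite inE.
  apply/forallP/and3P => [ea|[/eqP er _ /eqP ea] i].
    have {}ea i : #|e :&: block f i| = a i by apply/eqP.
    rewrite card_profile (eq_bigr _ (fun i _ => ea i)) sa eqxx; split=> //.
      by congr (_ != 1): a1; apply: eq_card => i; rewrite !inE ea.
    by apply/eqP/ffunP=> i; rewrite ffunE ea inord_val.
  by rewrite -ea ffunE inordK // ltnS -er subset_leq_card ?subsetIl.
apply: decomposes_le (subxx _) (leq0n _) _; apply: decomposes_none => e.
apply/negP=> /and3P[/eqP er e1 /eqP ea]; case/negP: bad.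
have aE i : a i = #|e :&: block f i| :> nat.
  by rewrite -ea ffunE inordK // ltnS -er subset_leq_card ?subsetIl.
rewrite (eq_bigr _ (fun i _ => aE i)) -card_profile er eqxx /=.
by congr (_ != 1): e1; apply: eq_card => i; rewrite !inE aE.
Qed.

(** The profile [a] records the blocks other than the one met in a single
    vertex. That vertex is free in the union of all blocks outside the support
    of [a], which is one part, so forgetting its position costs nothing. *)
Lemma decomposes_one_single a :
  decomposes setT r (profile_cost a) (fun e =>
    [&& #|e| == r, ones (fun i => #|e :&: block f i|) == 1
      & [ffun i => inord (if #|e :&: block f i| == 1 then 0 else #|e :&: block f i|)] == a]).
Proof.
have [/andP[/eqP sa /forallP a1]|bad] :=
    boolP ((\sum_i a i + 1 == r) && [forall i, a i != 1 :> nat]).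
  have oa := ones_weight a.
  have H : decomposes (region f (support a)) (\sum_i a i) (profile_cost a)
      (has_profile f (support a) (fun i => a i)).
    by apply: decomposes_profile_cost => //; [lia | move=> wk; split; [apply/forallP | lia]].
  have dis : [disjoint support a & ~: support a] by rewrite disjoints_subset setCK.
  have := decomposes_prod (disjoint_region f dis) H (decomposes_vertex _).
  rewrite muln1 sa -regionU setUCr => {}H.
  apply: eq_decomposes (decomposes_le (subsetT _) (leqnn _) H) => e.
  rewrite subsetIr /= (_ : e \subset _); last by apply/subsetP=> x; rewrite !inE.
  rewrite card_region /has_profile subsetIr /=.
  have -> : [forall i in support a, #|e :&: region f (support a) :&: block f i| == a i] =
      [forall i in support a, #|e :&: block f i| == a i].
    apply: eq_forallb_in => i iJ; by rewrite -setIA (setIidPr (block_sub_region f iJ)).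
  pose q i := #|e :&: block f i|.
  have er : #|e| = \sum_(i in support a) q i + \sum_(i in ~: support a) q i.
    rewrite card_profile (bigID (mem (support a))) /=; congr (_ + _).
    by apply: eq_bigl => i; rewrite in_setC.
  have sE : \sum_(i in support a) a i = \sum_i a i by apply: (sum_support (F := id)).
  apply/andP/and3P => [[/forall_inP qa /eqP q1]|[/eqP re /cards1P[i0 q1] /eqP ea]].
    have qE : \sum_(i in support a) q i = \sum_i a i.
      by rewrite -sE; apply: eq_bigr => i /qa /eqP.
    have [i0 i0a qi0] : exists2 i0, i0 \notin support a & forall i, i \notin support a -> q i = (i == i0).
      have [i0 [i0a qi0 q0]] := sum_nat_eq1 _ _ (introT eqP q1).
      exists i0; first by rewrite -in_setC.
      move=> i ia; have [->|ii] := eqVneq; first exact: qi0.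
      by apply: q0 => //; rewrite inE.
    split; first by rewrite er qE q1 sa.
      apply/cards1P; exists i0; apply/setP=> i; rewrite !inE -/(q i).
      have [ia|ia] := boolP (i \in support a); last by rewrite qi0 // eqb1.
      rewrite [q i](eqP (qa i ia)) (negPf (a1 i)).
      by apply/esym/negP=> /eqP ii; rewrite -ii ia in i0a.
    apply/eqP/ffunP=> i; rewrite ffunE -/(q i) -[RHS]inord_val; congr inord.
    have [ia|ia] := boolP (i \in support a).
      by rewrite [q i](eqP (qa i ia)) (negPf (a1 i)).
    rewrite qi0 //; move: ia; rewrite inE negbK => /eqP ->.
    by case: (i == i0).
  have aE i : a i = (if q i == 1 then 0 else q i) :> nat.
    rewrite -ea ffunE inordK // -/(q i) ltnS -re; case: ifP => // _.
    by rewrite subset_leq_card ?subsetIl.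
  have qa i : i \in support a -> q i = a i.
    by rewrite inE aE; case: ifP.
  split; first by apply/forall_inP=> i /qa /eqP.
  move: er; rewrite (eq_bigr _ qa) sE re => rE.
  by apply/eqP/(@addnI (\sum_i a i)); rewrite sa [RHS]rE.
apply: decomposes_le (subxx _) (leq0n _) _; apply: decomposes_none => e.
apply/negP=> /and3P[/eqP er /cards1P[i0 e1] /eqP ea]; case/negP: bad.
pose q i := #|e :&: block f i|.
have aE i : a i = (if q i == 1 then 0 else q i) :> nat.
  rewrite -ea ffunE inordK // -/(q i) ltnS -er; case: ifP => // _.
  by rewrite subset_leq_card ?subsetIl.
have q1 i : (q i == 1) = (i == i0) by have := in_set1 i i0; rewrite -e1 inE.
apply/andP; split; last first.
  by apply/forallP=> i; rewrite aE; case: ifP => // /negbT.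
rewrite -[X in _ == X]er card_profile (bigD1 i0) //= [X in _ == X](bigD1 i0) //= aE q1 eqxx.
rewrite -/(q i0); have /eqP -> : q i0 == 1 by rewrite q1.
rewrite add0n addn1 add1n eqSS; apply/eqP/eq_bigr => i ii.
by rewrite aE q1 (negPf ii).
Qed.

(** The factor 2 accounts for the two ways in which a function [a] can arise: as the
    full profile of a set, or as its profile with a lone 1 erased. *)
Lemma decomposes_blocks : 0 < #|I| ->
  decomposes setT r
   (2 * ('C(#|I|, k) * k.+1 * (pair_cost s ^ h * s ^ (k - h.*2))
         + (#|I| * r.+1) ^ k.-1 * s ^ k + r.+1 ^ #|I| * s ^ k.-1))
   (fun e => #|e| == r).
Proof.
move=> I0; apply: (@decomposes_le _ setT _ _ (\sum_a profile_cost a + \sum_a profile_cost a)) => //.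
  rewrite addnn -mul2n leq_mul2l /=.
  apply: (@leq_trans (\sum_a ((a \in main_profiles I r k) * (pair_cost s ^ h * s ^ (k - h.*2))
     + (a \in small_profiles I r k) * s ^ k + s ^ k.-1))).
    apply: leq_sum => a _; rewrite /profile_cost.
    by case: ifP => _; [|case: ifP => _]; rewrite ?mul0n ?mul1n ?add0n -?addnA ?leq_addr ?leq_addl.
  rewrite !big_split /= -!big_distrl /= sum_nat_const card_ffun card_ord.
  have cS (X : {set {ffun I -> 'I_r.+1}}) : \sum_a (a \in X) = #|X|.
    by rewrite -sum1_card [RHS]big_mkcond; apply: eq_bigr => a _; case: ifP.
  rewrite !cS leq_add // leq_add // leq_mul //; first exact: card_main_profiles.
  exact: card_small_profiles.
apply: (decomposes_split (b := fun e => ones (fun i => #|e :&: block f i|) == 1)).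
  apply: (decomposes_fibers (kappa := fun e => [ffun i => 
    inord (if #|e :&: block f i| == 1 then 0 else #|e :&: block f i|)])) => a.
  by apply: eq_decomposes (decomposes_one_single a) => e; rewrite andbA.
apply: (decomposes_fibers (kappa := fun e => [ffun i => inord #|e :&: block f i|])) => a.
by apply: eq_decomposes (decomposes_exact a) => e; rewrite andbA.
Qed.

End Assembly.

(** * From boxes to decompositions of the complete hypergraph *)

Section Decompositions.
Variable V : finType.
Implicit Types (e S : {set V}) (A : seq {set V}).

Definition edges A := [set e | transversal A e].

Lemma multipartite_edges r A : box setT r A -> edges A != set0 ->
  is_complete_multipartite r (edges A).
Proof.
move=> bA /set0Pn[e0]; rewrite inE => /andP[_ /allP e0A].
have /and3P[/eqP sA _ pA] := bA.
have ltA (i : 'I_r) : i < size A by rewrite sA.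
apply/existsP; exists [ffun i : 'I_r => nth set0 A i]; apply/and3P; split.
- apply/forallP=> i; rewrite ffunE; apply/negP=> /eqP Ai.
  by have := e0A _ (mem_nth set0 (ltA i)); rewrite Ai setI0 cards0.
- apply/forallP=> i; apply/forallP=> j; apply/implyP; rewrite !ffunE.
  have /(pairwiseP set0) {}pA := pA.
  rewrite -val_eqE neq_ltn => /orP[ij|ji]; first by apply: pA => //; apply: ltA.
  by rewrite disjoint_sym; apply: pA => //; apply: ltA.
apply/eqP/setP=> e; rewrite !inE; apply/idP/andP=> [te|[/eqP er /forallP eA]].
  split; first by rewrite (transversal_card bA te).
  move: te => /andP[_ /allP eA]; apply/forallP=> i; rewrite ffunE.
  exact: eA (mem_nth set0 (ltA i)).
have allA : all (fun S => #|e :&: S| == 1) A.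
  apply/(all_nthP set0) => i; rewrite sA => ir.
  by have := eA (Ordinal ir); rewrite ffunE.
rewrite /transversal allA andbT; set X := \bigcup_(S <- A) S.
have /(transversal_card bA) eX : transversal A (e :&: X).
  rewrite /transversal subsetIr; apply/allP=> S SA.
  have SX : S \subset X by rewrite /X (big_rem S SA) subsetUl.
  by rewrite -setIA (setIidPr SX); apply: (allP allA).
by apply/setIidPl/eqP; rewrite eqEcard subsetIl eX er leqnn.
Qed.

(** Boxes with an empty part have no transversal; once they are discarded,
    distinct edge sets come from distinct boxes and hence are disjoint. *)
Lemma decomposition_of_boxes r K : 0 < r ->
  decomposes [set: V] r K (fun e => #|e| == r) ->
  exists2 P : {set {set {set V}}}, is_decomposition r P & #|P| <= K.
Proof.
move=> r0 [L [sL /allP bL cL]].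
exists [set H in [seq edges A | A <- L] | H != set0]; last first.
  apply: leq_trans sL; rewrite -(size_map edges); apply: leq_trans (card_size _).
  by apply/subset_leq_card/subsetP=> H; rewrite !inE => /andP[].
apply/andP; split; last first.
  apply/forall_inP=> H; rewrite inE => /andP[/mapP[A AL ->]].
  by apply: multipartite_edges; apply: bL.
apply/and3P; split; last by rewrite !inE eqxx andbF.
- apply/eqP/setP=> e; apply/bigcupP/idP => [[H]|].
    rewrite inE => /andP[/mapP[A AL ->] _]; rewrite !inE.
    by move=> /(transversal_card (bL A AL)) ->.
  rewrite inE => er; have : has (fun A => transversal A e) L by rewrite has_count cL er.
  case/hasP=> A AL te; have eA : e \in edges A by rewrite inE.
  have nA : edges A != set0 by apply/set0Pn; exists e.
  by exists (edges A) => //; rewrite inE nA andbT; apply: map_f.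
apply/trivIsetP=> H1 H2; rewrite !inE => /andP[/mapP[A1 L1 ->] _] /andP[/mapP[A2 L2 ->] _] ne.
rewrite -setI_eq0; apply: contraR ne => /set0Pn[e]; rewrite !inE => /andP[t1 t2].
have er : #|e| == r by rewrite (transversal_card (bL _ L1) t1).
have := cL e; rewrite er -size_filter => /eqP.
have m1 : A1 \in [seq A <- L | transversal A e] by rewrite mem_filter t1.
have m2 : A2 \in [seq A <- L | transversal A e] by rewrite mem_filter t2.
by case: (filter _ _) m1 m2 => [|B [|//]] //; rewrite !inE => /eqP -> /eqP ->.
Qed.

End Decompositions.

Lemma f_le r n K : 0 < r ->
  decomposes [set: 'I_n] r K (fun e => #|e| == r) -> f_ r n <= K.
Proof.
move=> r0 /(decomposition_of_boxes r0)[P dP PK]; apply: leq_trans PK.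
rewrite /f_; case: ex_minnP => m _; apply.
by apply/existsP; exists P; rewrite dP eqxx.
Qed.

Lemma f_le_pow r n : 0 < r -> f_ r n <= n ^ r./2.
Proof.
move=> r0; apply: f_le => //.
have := @decomposes_complete 'I_n n r setT; rewrite cardsT card_ord => /(_ (leqnn _)).
by apply: eq_decomposes => e; rewrite subsetT.
Qed.

Lemma f_le_blocks t r n (k := r./2) (s := (n %/ t).+1) (h := k.-1./2) : 0 < r -> 0 < t ->
  f_ r n <= 2 * ('C(t, k) * k.+1 * (pair_cost s ^ h * s ^ (k - h.*2))
         + (t * r.+1) ^ k.-1 * s ^ k + r.+1 ^ t * s ^ k.-1).
Proof.
case: t @s => // t s r0 _; apply: f_le => //.
pose f (x : 'I_n) : 'I_t.+1 := inord (x %% t.+1).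
have fE x : f x = x %% t.+1 :> nat by rewrite inordK // ltn_mod.
have block_le i : #|block f i| <= s.
  pose g (x : 'I_n) : 'I_s := inord (x %/ t.+1).
  have gE x : g x = x %/ t.+1 :> nat by rewrite inordK // ltnS leq_div2r // ltnW.
  rewrite -(card_in_imset (f := g)) => [|x y]; first by apply: leq_trans (max_card _) _; rewrite card_ord.
  rewrite !inE => /eqP fx /eqP fy gxy; apply/val_inj => /=.
  by rewrite (divn_eq x t.+1) (divn_eq y t.+1) -!gE -!fE fx fy gxy.
have := decomposes_blocks r block_le (_ : 0 < s).
by rewrite card_ord; apply.
Qed.

(** * Comparison with the binomial coefficient *)

Lemma pair_cost_le s : 15 * pair_cost s <= 14 * (s + 5) ^ 2.
Proof.
rewrite /pair_cost; have s3 : 3 * (s %/ 3 + 1) <= s + 5 by lia.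
have s5 : 5 * (s %/ 5 + 1) <= s + 5 by lia.
have := leq_mul s3 s5; rewrite -(leq_pmul2l (isT : 0 < 14)).
by apply: leq_trans; rewrite -mulnACA; lia.
Qed.

(** Bernoulli's inequality for 15/14. *)
Lemma exp15_ge j : (14 + j) * 14 ^ j <= 14 * 15 ^ j.
Proof. by elim: j => [|j IH] //; rewrite !expnS; nia. Qed.

(** Exponential decay beats the number of main profiles: (14/15)^h is
    O(1 / (k + 1)^2). Bernoulli's inequality gives only 1/k, so it is applied to
    [h./2] and squared; 56 = 4 * 14. *)
Lemma exp14_le k (h := k.-1./2) : k.+1 ^ 2 * 14 ^ h <= 56 ^ 2 * 15 ^ h.
Proof.
pose j := h./2; have hE : h = odd h + (j + j) by rewrite addnn odd_double_half.
have kj : k.+1 <= 4 * (14 + j) by rewrite /j /h; lia.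
have odd_le : 14 ^ odd h <= 15 ^ odd h by case: (odd h).
rewrite [in 14 ^ _]hE [in 15 ^ _]hE !expnD.
apply: (@leq_trans (4 ^ 2 * (14 ^ odd h * ((14 + j) * 14 ^ j) ^ 2))).
  have -> : 4 ^ 2 * (14 ^ odd h * ((14 + j) * 14 ^ j) ^ 2) =
            (4 * (14 + j)) ^ 2 * (14 ^ odd h * (14 ^ j * 14 ^ j)) by rewrite !expnMn; ring.
  by rewrite leq_mul // leq_sqr.
have -> : 56 ^ 2 * (15 ^ odd h * (15 ^ j * 15 ^ j)) =
          4 ^ 2 * (15 ^ odd h * (14 * 15 ^ j) ^ 2) by rewrite (expnMn 4 14) expnMn; ring.
by rewrite leq_mul // leq_mul // leq_sqr exp15_ge.
Qed.

Lemma leq_expW m n i : m <= n -> m ^ i <= n ^ i.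
Proof. by case: i => // i mn; rewrite leq_exp2r. Qed.

Lemma ffact_le_exp n k : n ^_ k <= n ^ k.
Proof.
by elim: k => // k IH; rewrite ffactnSr expnSr leq_mul // leq_subr.
Qed.

Lemma exp_le_ffact n k : (n - k) ^ k <= n ^_ k.
Proof.
elim: k => // k IH; rewrite ffactnSr expnSr leq_mul //; last by lia.
by apply: leq_trans IH; apply: leq_expW; lia.
Qed.

(** Bernoulli's inequality in the form (1 + d/m)^k <= 2, which allows
    n^k to be compared with (n - k)^k for large n. *)
Lemma exp_shift_le m d k : 2 * k * d <= m -> (m + d) ^ k <= 2 * m ^ k.
Proof.
case: (posnP k) => [-> //|k0 dm].
have H j : j <= k -> (m + d) ^ j * (2 * k - j) <= 2 * k * m ^ j.
  elim: j => [|j IH] jk; first by rewrite !expn0; lia.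
  have {}IH := IH (ltnW jk).
  have step : (m + d) * (2 * k - j.+1) <= m * (2 * k - j).
    have -> : 2 * k - j = (2 * k - j.+1).+1 by lia.
    by nia.
  rewrite !expnSr -mulnA; apply: leq_trans (leq_mul (leqnn _) step) _.
  by rewrite mulnCA mulnC [in X in _ <= X]mulnA leq_mul.
have := H k (leqnn k); rewrite (_ : 2 * k - k = k); last by lia.
by rewrite mulnC -mulnA mulnCA leq_pmul2l.
Qed.

(** The number [t] of blocks makes the small profiles contribute at most
    1/(k + 1) of the total; [n] is then taken large enough for the profiles of
    smaller exponent and for the rounding errors. The factor 4 comes from the two
    kinds of profiles and from [exp_shift_le]. *)
Lemma f_le_bin r : 0 < r -> exists N, forall n, N <= n ->
  (r./2).+1 * f_ r n <= 4 * (56 ^ 2 + 2) * 'C(n, r./2).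
Proof.
move=> r0; have [k0|k0] := posnP r./2.
  exists 0 => n _; have := f_le_pow n r0; rewrite k0 bin0; lia.
set k := r./2 in k0 *; pose h := k.-1./2.
pose t := k.+1 * k`! * r.+1 ^ k.-1.
have t0 : 0 < t by rewrite !muln_gt0 fact_gt0 expn_gt0.
exists (k + 2 * k * (6 * t + k) + k.+1 * k`! * r.+1 ^ t) => n nN.
pose s := (n %/ t).+1; pose y := s + 5.
have nty : n <= t * y.
  by rewrite /y /s; apply: ltnW; rewrite [n in n < _](divn_eq n t) mulnC; have := ltn_pmod n t0; nia.
have tyn : t * y <= n + 6 * t.
  by rewrite /y /s; have := divn_eq n t; nia.
have fB := f_le_blocks n r0 t0; rewrite -/k -/h -/s in fB.
have sy i : s ^ i <= y ^ i by apply: leq_expW; rewrite leq_addr.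
have tE : t = k.+1 * k`! * r.+1 ^ k.-1 by [].
have mul4 a b c d : a * (b * c * d) = a * c * (b * d) by ring.
have main : k.+1 * k`! * ('C(t, k) * k.+1 * (pair_cost s ^ h * s ^ (k - h.*2)))
    <= 56 ^ 2 * (t * y) ^ k.
  have P15 : 15 ^ h * pair_cost s ^ h <= 14 ^ h * y ^ h.*2.
    by rewrite -mul2n expnM -!expnMn leq_expW // pair_cost_le.
  have Ct : k`! * 'C(t, k) <= t ^ k by rewrite mulnC bin_ffact ffact_le_exp.
  have hk : h.*2 <= k.
    by apply: leq_trans (leq_pred k); rewrite -[X in _ <= X]odd_double_half leq_addl.
  (* The factor 15^h clears the denominators of (14/15)^h. *)
  rewrite -(leq_pmul2l (_ : 0 < 15 ^ h)) ?expn_gt0 //.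
  apply: (@leq_trans (k.+1 ^ 2 * (k`! * 'C(t, k)) *
      ((15 ^ h * pair_cost s ^ h) * s ^ (k - h.*2)))).
    by move: (15 ^ h) (pair_cost s ^ h) (s ^ _) => x1 x2 x3; apply: eq_leq; ring.
  apply: (leq_trans (leq_mul (leq_mul (leqnn _) Ct) (leq_mul P15 (sy _)))).
  rewrite -[_ * _ * y ^ _]mulnA -expnD subnKC //.
  apply: (@leq_trans (k.+1 ^ 2 * 14 ^ h * (t * y) ^ k)).
    by rewrite expnMn; move: (14 ^ h) (t ^ k) (y ^ k) => x1 x2 x3; apply: eq_leq; ring.
  apply: leq_trans (leq_mul (exp14_le k) (leqnn _)) _.
  by rewrite -/h [15 ^ h * (_ * _)]mulnA [15 ^ h * _]mulnC.
have small : k.+1 * k`! * ((t * r.+1) ^ k.-1 * s ^ k) <= (t * y) ^ k.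
  have -> : (t * y) ^ k = t * (t ^ k.-1 * y ^ k).
    by rewrite expnMn -[in t ^ k](prednK k0) expnS mulnA.
  by rewrite (expnMn t) mul4 -tE !leq_mul.
have negl : k.+1 * k`! * (r.+1 ^ t * s ^ k.-1) <= (t * y) ^ k.
  rewrite -[k in (t * y) ^ k](prednK k0) expnS mulnA leq_mul //.
    by apply: leq_trans nty; apply: leq_trans nN; rewrite leq_addl.
  by apply: leq_trans (sy _) _; apply: leq_expW; rewrite leq_pmull.
have shift : (t * y) ^ k <= 2 * (n - k) ^ k.
  have knN : k + 2 * k * (6 * t + k) <= n by apply: leq_trans nN; apply: leq_addr.
  have kn : k <= n by apply: leq_trans knN; apply: leq_addr.
  have dn : 2 * k * (6 * t + k) <= n - k by rewrite leq_subRL.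
  by apply: leq_trans (exp_shift_le dn); apply: leq_expW; rewrite addnCA subnK // addnC.
rewrite -(leq_pmul2l (fact_gt0 k)).
apply: (@leq_trans (2 * (56 ^ 2 + 2) * (t * y) ^ k)).
  rewrite mulnA [k`! * _]mulnC; apply: leq_trans (leq_mul (leqnn _) fB) _.
  move: (56 ^ 2) ((t * y) ^ k) main small negl => X Y main small negl.
  rewrite (mulnCA _ 2) -[2 * _ * _]mulnA leq_pmul2l // !mulnDr mulnDl mul2n -(addnn Y) addnA.
  by rewrite !leq_add.
apply: leq_trans (leq_mul (leqnn _) shift) _.
apply: leq_trans (leq_mul (leqnn _) (leq_mul (leqnn _) (exp_le_ffact n k))) _.
rewrite -bin_ffact; move: (56 ^ 2) => X; apply: eq_leq; ring.
Qed.

(** * The limit *)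

(* Imported only here: these theories redefine the notations for finite sets. *)
From mathcomp Require Import all_classical all_reals all_analysis.
Import Order.TTheory GRing.Theory Num.Theory.
Import numFieldNormedType.Exports.
Local Open Scope classical_set_scope.
Local Open Scope ring_scope.

(** The constant exceeds the upper limit of the ratio, so the error function 0 is
    a valid witness. *)
Lemma asymptotic_bound_half (R : realType) (r : nat) : (0 < r)%N ->
  asymptotic_bound r ((4 * (56 ^ 2 + 2))%N%:R / (r./2).+1%:R : R).
Proof.
move=> r0; exists (fun=> 0); split; first exact: cvg_cst.
have [N HN] := f_le_bin r0; exists N => // n /= /HN; move: (4 * _)%N => K fn.
rewrite addr0 mulr1 mulrAC ler_pdivlMr ?ltr0n // mulrC.
by rewrite -!natrM ler_nat.
Qed.

Theorem corollary3 (R : realType) :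
  exists o : R^nat, o @ \oo --> (0 : R) /\
    forall r : nat, (1 <= r)%N ->
      (c_ R r <= (r%:R / 2 * (14 / 15) `^ (r%:R / 4) + o r)%:E)%E.
Proof.
pose K : nat := (2 * (4 * (56 ^ 2 + 2)))%N.
exists (fun r => K%:R * harmonic r); split.
  by rewrite -[0](mulr0 K%:R); apply: cvgM; [exact: cvg_cst | exact: cvg_harmonic].
move=> r r0; apply: (@le_trans _ _ ((4 * (56 ^ 2 + 2))%N%:R / (r./2).+1%:R : R)%:E).
  by apply: ereal_inf_lbound; exists ((4 * (56 ^ 2 + 2))%N%:R / (r./2).+1%:R) => //;
     apply: asymptotic_bound_half.
rewrite lee_fin; apply: ler_wpDl; first by rewrite mulr_ge0 ?powR_ge0 // divr_ge0.
rewrite /K; move: (4 * _)%N => X; rewrite /harmonic /=.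
rewrite ler_pdivrMr ?ltr0n // mulrAC ler_pdivlMr ?ltr0n // -!natrM ler_nat.
by rewrite (mulnC 2) -mulnA leq_mul //; lia.
Qed.
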